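(* For all integers $p,k\ge1$, the limiting joint probabilities $\mathbb P(P=p,K=k):=\lim_{n\to\infty}\mathbb P(P_n=p,K_n=k)$ are given by $$\mathbb P(P=p,K=k)=2^{-pk}(1-2^{-p}),$$ and these probabilities sum to $1$ over all $p,k\ge1$.
   Context: $\mathcal C_n$ is the set of integer compositions of $n$, i.e. ordered sequences $\alpha=(a_1,\ldots,a_\ell)$ of integers $a_i\ge1$ with sum $n$. The initial run of $\alpha$ is the maximal prefix $(a_1,\ldots,a_k)$ whose entries are all equal; $P(\alpha)=a_1$ and $K(\alpha)=k$ is the number of parts in it. For each $n\ge1$, $\alpha_n$ is uniformly distributed on $\mathcal C_n$, $P_n=P(\alpha_n)$ and $K_n=K(\alpha_n)$. *)

(* Defs.v *)
From HB Require Import structures.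
From mathcomp Require Import all_boot all_order all_algebra.
From mathcomp Require Import all_classical all_reals all_analysis.
Set Implicit Arguments.
Unset Strict Implicit.
Unset Printing Implicit Defensive.
Import Order.TTheory GRing.Theory Num.Theory.
Import numFieldNormedType.Exports.

Local Open Scope ring_scope.

Record composition (n : nat) := Composition {
  parts :> seq nat;
  _ : all (leq 1) parts && (sumn parts == n) }.

HB.instance Definition _ n := [isSub for @parts n].
HB.instance Definition _ n := [Countable of composition n by <:].

(* Finiteness: the parts and their number are at most n, so composition n
   embeds into the sequences of length at most n over 'I_n.+1. *)
Definition composition_code n (a : composition n) : n.-bseq 'I_n.+1 :=
  insub_bseq n (map inord (parts a)).

Definition composition_decode n (b : n.-bseq 'I_n.+1) : option (composition n) :=
  insub (map val b).

Lemma composition_codeK n :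
  pcancel (@composition_code n) (@composition_decode n).
Proof.
case=> s hs; rewrite /composition_decode /composition_code /=.
have [hpos /eqP hsum] := andP hs.
have hsize : (size s <= n)%N.
  rewrite -hsum; elim: {hs hsum} s hpos => //= x s IHs /andP[hx /IHs].
  by move=> hle; rewrite -add1n leq_add.
have hpart x : x \in s -> (x <= n)%N.
  rewrite -hsum; elim: {hs hpos hsum hsize} s => //= y s IHs.
  rewrite inE => /predU1P[-> | /IHs hle]; first exact: leq_addr.
  exact: leq_trans hle (leq_addl _ _).
have -> : map val (insub_bseq n (map (@inord n) s)) = s.
  rewrite /insub_bseq insubdK ?unfold_in /= ?size_map // -map_comp.
  by rewrite map_id_in // => x /hpart hx /=; rewrite inordK.
by rewrite (insubT (fun s => all (leq 1) s && (sumn s == n)) hs).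
Qed.

HB.instance Definition _ n : fintype.isFinite (composition n) :=
  fintype.isFinite.Build (composition n) (pcan_enumP (@composition_codeK n)).

Definition initial_run (s : seq nat) : seq nat :=
  take (\max_(i < (size s).+1 | constant (take i s)) i) s.

(* The default 0 only serves the empty composition, which occurs for n = 0. *)
Definition initial_part (s : seq nat) : nat := head 0%N s.

Definition initial_run_length (s : seq nat) : nat := size (initial_run s).

Definition uniform_prob (R : realType) (T : finType) (E : pred T) : R :=
  #|E|%:R / #|T|%:R.

(* P(P_n = p, K_n = k) for a uniformly distributed composition of n *)
Definition run_prob (R : realType) (p k n : nat) : R :=
  @uniform_prob R (composition n)
    (fun a => (initial_part a == p) && (initial_run_length a == k)).

(* Main.v *)
Require Import Defs.
From HB Require Import structures.
From mathcomp Require Import all_boot all_order all_algebra.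
From mathcomp Require Import all_classical all_reals all_analysis.
Import Order.TTheory GRing.Theory Num.Theory.
Import numFieldNormedType.Exports.
Local Open Scope classical_set_scope.
Local Open Scope ring_scope.

(** Deleting the first j parts is a bijection from the compositions of n that
begin with j copies of p onto the compositions of n - pj.  There are 2^(n-1)
compositions of n >= 1, so a fraction 2^(-pj) of them begins with j copies of
p as soon as n > pj ([card_prefix_composition], [card_composition]).  When
k >= 1, the initial run is exactly k copies of p if and only if the
composition begins with k copies of p but not with k + 1
([initial_runE]).  Hence the probability of that event is
2^(-pk) - 2^(-p(k+1)) for every n > p(k+1) ([run_prob_large]): the sequence is
eventually constant, and its limit needs no estimate.

The total mass is found by summing two geometric series ([esum_geometric]).
For fixed p >= 1, the sum over k >= 1 of 2^(-pk) (1 - 2^(-p)) is 2^(-p), and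
the sum of 2^(-p) over p >= 1 is 1. *)

Definition is_composition (n : nat) (s : seq nat) : bool :=
  all (leq 1) s && (sumn s == n).

Lemma is_compositionP {n : nat} (a : composition n) : is_composition n a.
Proof. by case: a. Qed.

(** The bijection is given on underlying sequences, so that its values need no
proof of being compositions until they are counted. *)
Lemma card_composition_bij {m n : nat} (P : pred (seq nat))
    (f g : seq nat -> seq nat) :
  (forall s, is_composition m s ->
     [/\ is_composition n (f s), P (f s) & g (f s) = s]) ->
  (forall t, is_composition n t -> P t ->
     is_composition m (g t) /\ f (g t) = t) ->
  #|[pred b : composition n | P b]| = #|{: composition m}|.
Proof.
move=> fP gP.
pose F (a : composition m) : composition n :=
  let: And3 fa _ _ := fP a (is_compositionP a) in Composition fa.
have FE a : parts (F a) = f a by rewrite /F; case: (fP _ _).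
have F_inj : injective F.
  move=> a b /(congr1 (@parts n)); rewrite !FE => /(congr1 g).
  have [_ _ ->] := fP a (is_compositionP a).
  have [_ _ ->] := fP b (is_compositionP b).
  exact: val_inj.
rewrite -(card_codom F_inj); apply: eq_card => b; rewrite inE.
apply/idP/codomP => [Pb|[a ->]]; last first.
  by rewrite FE; have [] := fP a (is_compositionP a).
have [gb fgb] := gP b (is_compositionP b) Pb.
by exists (Composition gb); apply: val_inj; rewrite /= FE fgb.
Qed.

Lemma card_prefix_composition (p j m : nat) : (1 <= p)%N ->
  #|[pred a : composition (p * j + m) | prefix (nseq j p) a]|
    = #|{: composition m}|.
Proof.
move=> p1.
apply: (card_composition_bij (prefix (nseq j p))
          (cat (nseq j p)) (drop j)).
  move=> s /andP[s1 /eqP sm]; split; last 2 first.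
  - exact: prefix_prefix.
  - by rewrite drop_size_cat // size_nseq.
  rewrite /is_composition all_cat s1 all_nseq p1 orbT.
  by rewrite sumn_cat sumn_nseq sm /=.
move=> t /andP[t1 /eqP tn] /prefixP[u tE]; move: t1 tn.
rewrite tE drop_size_cat ?size_nseq // all_cat sumn_cat sumn_nseq.
by move=> /andP[_ u1] /addnI um; split=> //; rewrite /is_composition u1 um /=.
Qed.

(** Induction on n: a composition of n + 2 arises from a composition of n + 1
in exactly one of two ways, prepending a part 1 or increasing the first part
by 1. *)
Lemma card_composition (n : nat) : #|{: composition n.+1}| = (2 ^ n)%N.
Proof.
elim: n => [|n IHn].
  have one : is_composition 1 [:: 1%N] by [].
  apply: (fintype.eq_card1 (x := Composition one)) => -[s /= s1]; rewrite !inE.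
  apply/esym/eqP/val_inj => /=.
  by move: s1; case: s => [|[|[|x]] [|[|y] s]] //=; rewrite ?andbF.
rewrite -(cardC [pred a : composition n.+2 | prefix (nseq 1 1%N) a]).
rewrite (card_prefix_composition 1 1 n.+1) // IHn.
suff -> : #|[predC [pred a : composition n.+2 | prefix (nseq 1 1%N) a]]|
    = #|{: composition n.+1}| by rewrite IHn expnS mul2n addnn.
pose decr_head s := if s is x :: s' then x.-1 :: s' else [::].
apply: (card_composition_bij (predC (prefix (nseq 1 1%N)))
          (fun s => incr_nth s 0) decr_head).
  by rewrite /is_composition => -[|[|x] s].
by rewrite /is_composition => -[|[|[|x]] s] //=; rewrite prefix0s.
Qed.

(** The constant prefixes are the repetitions of the first part; they are
closed under shortening, so the maximum that defines the initial run
decides for each j whether the first j parts agree. *)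
Lemma leq_initial_run_length (s : seq nat) (p j : nat) :
  s != [::] -> initial_part s = p ->
  (j <= initial_run_length s)%N = prefix (nseq j p) s.
Proof.
move=> s0 sp.
have constE i : (i <= size s)%N ->
    constant (take i s) = (take i s == nseq i p).
  move=> le_is; case: s s0 sp le_is => // x s _ /= ->; case: i => // i /= le_is.
  rewrite eqseq_cons eqxx /=; have st : size (take i s) = i by rewrite size_takel.
  by apply/all_pred1P/eqP; rewrite st.
rewrite /initial_run_length /initial_run.
set m := (\max_(i < _ | _) _)%N.
have le_ms : (m <= size s)%N by apply/bigmax_leqP => i _; rewrite -ltnS.
rewrite size_takel // prefixE size_nseq.
have /eqP mP : take m s == nseq m p.
  rewrite -constE // /m.
  have [|i ci ->] := @eq_bigmax_cond _
      [pred i : 'I_(size s).+1 | constant (take i s)] (@nat_of_ord _).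
    by apply/card_gt0P; exists ord0; rewrite inE take0.
  by move: ci; rewrite inE.
apply/idP/eqP => [le_jm|jP].
  by rewrite -(take_takel s le_jm) mP take_nseq.
have le_js : (j <= size s)%N.
  have := congr1 size jP; rewrite size_nseq size_take_min => <-.
  exact: geq_minr.
have lt_js : (j < (size s).+1)%N by [].
apply: (leq_bigmax_cond (Ordinal lt_js)) => /=.
by rewrite jP constant_nseq.
Qed.

(** The condition 1 <= k makes the composition nonempty and fixes its first
part, which the two prefix conditions would not do for k = 0. *)
Lemma initial_runE (s : seq nat) (p k : nat) : (1 <= k)%N ->
  (initial_part s == p) && (initial_run_length s == k)
    = prefix (nseq k p) s && ~~ prefix (nseq k.+1 p) s.
Proof.
case: k => // k _; case: s => [|x s].
  by rewrite /initial_run_length /initial_run /= andbF.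
have [xp|xp] := eqVneq (initial_part (x :: s)) p.
  by rewrite -!leq_initial_run_length // -ltnNge ltnS -eqn_leq eq_sym.
by rewrite /= (eq_sym p) (negPf xp).
Qed.

Lemma run_prob_large (R : realType) (p k n : nat) :
  (1 <= p)%N -> (1 <= k)%N -> (p * k.+1 < n)%N ->
  run_prob R p k n = 2 ^- (p * k) * (1 - 2 ^- p).
Proof.
move=> p1 k1 lt_n.
pose A j := [pred a : composition n | prefix (nseq j p) a].
have cardA j : (p * j < n)%N ->
    #|A j|%:R = 2 ^- (p * j) * #|{: composition n}|%:R :> R.
  move=> lt_jn; rewrite /A -(subnKC lt_jn) addSnnS.
  rewrite card_prefix_composition // addnS !card_composition.
  by rewrite !natrX exprD mulKf.
have n0 : #|{: composition n}|%:R != 0 :> R.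
  case: n {A cardA} lt_n => // n _.
  by rewrite card_composition pnatr_eq0 expn_eq0.
have le_kn : (p * k < n)%N.
  by apply: leq_ltn_trans lt_n; rewrite leq_mul2l leqnSn orbT.
pose E (a : composition n) :=
  (initial_part a == p) && (initial_run_length a == k).
have sub (s : seq nat) : prefix (nseq k.+1 p) s -> prefix (nseq k p) s.
  by rewrite -addn1 nseqD => /prefixP[u ->]; rewrite -catA prefix_prefix.
have cardE : #|E|%:R = #|A k|%:R - #|A k.+1|%:R :> R.
  rewrite -(cardID (A k.+1) (A k)) [X in (X + _)%N](_ : _ = #|A k.+1|).
    rewrite natrD addrAC subrr add0r; congr _%:R.
    by apply: eq_card => a; rewrite !inE [RHS]andbC; exact: initial_runE.
  apply: eq_card => a; rewrite !inE; apply/andP/idP => [[]//|h].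
  by split=> //; exact: sub.
have -> : run_prob R p k n = #|E|%:R / #|{: composition n}|%:R by [].
rewrite cardE !cardA // -mulrBl mulfK // mulnS exprD invfM.
by rewrite mulrBr mulr1 [in RHS]mulrC [_^-1 * _]mulrC.
Qed.

Lemma cvg_run_prob (R : realType) {p k : nat} : (1 <= p)%N -> (1 <= k)%N ->
  run_prob R p k n @[n --> \oo] --> (2 ^- (p * k) * (1 - 2 ^- p) : R).
Proof.
move=> p1 k1; apply: cvg_near_cst.
by near=> n; apply: run_prob_large => //; near: n; exact: nbhs_infty_gt.
Unshelve. all: by end_near. Qed.

Lemma esum_geometric (R : realType) (a z : R) : 0 <= a -> 0 <= z < 1 ->
  (\esum_(k in [set k : nat | (1 <= k)%N]) (a * z ^+ k)%:E
    = (a * z / (1 - z))%:E)%E.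
Proof.
move=> a0 /andP[z0 z1].
rewrite (@reindex_esum R _ _ [set: nat] _ succn); last first.
  split=> [k _ //|k l _ _ [] //|[|k] //= _]; by exists k.
rewrite -nneseries_esumT => [|k]; last by rewrite lee_fin mulr_ge0 ?exprn_ge0.
under eq_eseriesr do rewrite exprS mulrA.
apply/cvg_lim => //; apply: cvg_EFin; first by near=> n; rewrite sumEFin.
have := @cvg_geometric_series R (a * z) z; rewrite ger0_norm // => /(_ z1).
apply: cvg_trans; apply: near_eq_cvg; near=> n.
by rewrite /= sumEFin.
Unshelve. all: by end_near. Qed.

Theorem corollary5p1 (R : realType) :
  (forall p k : nat, (1 <= p)%N -> (1 <= k)%N ->
     run_prob R p k n @[n --> \oo] --> (2 ^- (p * k) * (1 - 2 ^- p) : R)) /\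
  (\esum_(pk in [set pk : nat * nat | (1 <= pk.1)%N /\ (1 <= pk.2)%N])
     (lim (run_prob R pk.1 pk.2 n @[n --> \oo]))%:E = 1)%E.
Proof.
split; first exact: cvg_run_prob.
pose q (p : nat) : R := 2 ^- p.
have q0 p : 0 <= q p by rewrite /q invr_ge0 exprn_ge0.
have q1 p : (1 <= p)%N -> q p < 1.
  by move=> p1; rewrite /q invf_lt1 ?exprn_gt0 // exprn_egt1 ?ltr1n // -lt0n.
have qX p k : q (p * k)%N = q p ^+ k by rewrite /q exprM exprVn.
rewrite (eq_esum (b := fun pk => ((1 - q pk.1) * q pk.1 ^+ pk.2)%:E)); last first.
  move=> [p k] /= [p1 k1]; rewrite (cvg_lim _ (cvg_run_prob R p1 k1)) //.
  by rewrite mulrC -qX.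
set I := [set k : nat | (1 <= k)%N].
rewrite (_ : [set pk : nat * nat | _] = I `*`` fun=> I) //.
rewrite -(@esum_esum R _ _ I (fun=> I) (fun p k => ((1 - q p) * q p ^+ k)%:E)).
  rewrite (eq_esum (b := fun p => (1 * q 1%N ^+ p)%:E)) => [|p p1]; last first.
    rewrite esum_geometric ?subr_ge0 ?q0 ?q1 //; last exact/ltW/q1.
    by rewrite mulrAC mulfV ?subr_eq0 ?gt_eqF ?q1 // -qX mul1n.
  rewrite esum_geometric ?q0 ?q1 //; congr _%:E.
  (* Both the ratio q 1 and its complement are 1/2. *)
  have -> : 1 - q 1%N = q 1%N.
    by apply/eqP; rewrite subr_eq /q expr1 [eqbLHS]splitr div1r.
  by rewrite mul1r divff // /q expr1 invr_eq0 pnatr_eq0.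
move=> p k p1 _; rewrite lee_fin mulr_ge0 ?exprn_ge0 // subr_ge0.
exact/ltW/q1.
Qed.
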